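(* Let $G$ be a finite directed graph and $C$ a cycle of $G$. Then $$\varphi(G)=\varphi(T_C(G)),\qquad\text{where}\qquad T_C(G)=\sum_{\substack{E'\subset HE(C)\\ E'\neq\emptyset}}(-1)^{|E'|-1}\, G\setminus E',$$ that is, $\varphi(G)=\sum_{\emptyset\neq E'\subset HE(C)}(-1)^{|E'|-1}\varphi(G\setminus E')$.
   Context: A graph $G$ consists of a finite vertex set $V_G$ and an edge set $E_G\subset V_G\times V_G$; for $e=(u,v)$ write $\alpha(e)=u$ (origin), $\omega(e)=v$ (end), and $\overline{e}=(v,u)$. A linear extension of $G$ is a total order $\le_w$ on $V_G$ such that $\alpha(e)\le_w\omega(e)$ for every $e\in E_G$; it is identified with the word $w$ listing the vertices in increasing order. $\mathcal L(G)$ denotes the set of linear extensions and $\varphi(G)=\sum_{w\in\mathcal L(G)}w$, an element of the free abelian group on words; $\varphi$ is extended linearly to formal $\mathbb Z$-linear combinations of graphs. A cycle of $G$ is a sequence $(e_1,\dots,e_k)$ of elements of $E_G\cup\{\overline e: e\in E_G\}$ with $\omega(e_i)=\alpha(e_{i+1})$ for $i<k$ and $\omega(e_k)=\alpha(e_1)$, all $e_i$ distinct and all vertices visited distinct; $HE(C)$ denotes the set of those $e_i$ that belong to $E_G$. For $E'\subset E_G$, $G\setminus E'$ is the graph with vertex set $V_G$ and edge set $E_G\setminus E'$.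
   Formalization: A cycle may not go back and forth along one edge: C = (e, ē) with only one of e, ē in E_G is excluded, since there the identity fails (V = {1,2}, E_G = {(1,2)}: 12 versus 12 + 21); two opposite edges of G still form a cycle. *)

(* Defs.v *)
From HB Require Import structures.
From mathcomp Require Import all_boot all_algebra.
From mathcomp.multinomials Require Import freeg.

Set Implicit Arguments.
Unset Strict Implicit.
Unset Printing Implicit Defensive.

Import GRing.Theory.
Local Open Scope ring_scope.

(* A graph with vertex set V is given by its edge set; [alpha] and [omega] are
   the two projections. *)
Notation digraph V := {set V * V}.

Section Digraphs.
Variable V : finType.
Implicit Types (G : digraph V) (e : V * V) (C : seq (V * V)).

Definition alpha e : V := e.1.
Definition omega e : V := e.2.
Definition ebar e : V * V := (omega e, alpha e).

(* A binary relation O on V is the set of pairs (x, y) with x <=_O y. *)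
Definition ord_le (O : {set V * V}) : rel V := fun x y => (x, y) \in O.

Definition total_order (O : {set V * V}) : bool :=
  [&& [forall x, ord_le O x x],
      [forall x, forall y, (ord_le O x y && ord_le O y x) ==> (x == y)],
      [forall x, forall y, forall z,
         (ord_le O x y && ord_le O y z) ==> ord_le O x z]
    & [forall x, forall y, ord_le O x y || ord_le O y x]].

Definition linear_extensions G : {set {set V * V}} :=
  [set O | total_order O & [forall e in G, ord_le O (alpha e) (omega e)]].

(* The vertices listed in increasing order for the total order O. *)
Definition word_of (O : {set V * V}) : seq V := sort (ord_le O) (enum V).

Definition phi G : {freeg (seq V) / int} :=
  \sum_(O in linear_extensions G) << word_of O >>.

Definition phi_lin : {freeg (digraph V) / int} -> {freeg (seq V) / int} :=
  fglift phi.

(* The vertices visited by a closed sequence of steps are the origins of the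
   steps. The steps of a cycle are distinct as edges of G, not merely as
   ordered pairs: going back and forth along one and the same edge,
   C = (e, ebar e) with only one of e, ebar e in G, is not a cycle, whereas two
   opposite edges of G do form a cycle of length 2. The last clause expresses
   this; for sequences of length other than 2 it follows from the others. *)
Definition is_cycle G C : bool :=
  [&& C != [::],
      all (fun e => (e \in G) || (ebar e \in G)) C,
      path.cycle (fun e f => omega e == alpha f) C,
      uniq C,
      uniq (map alpha C)
    & all (fun e => (ebar e \in C) ==> (e \in G)) C].

Definition HE G C : {set V * V} := [set e in C | e \in G].

Definition gdel G (E' : {set V * V}) : digraph V := G :\: E'.

Definition T_op G C : {freeg (digraph V) / int} :=
  \sum_(E' : {set V * V} | (E' \subset HE G C) && (E' != set0))
     (-1 : int) ^+ (#|E'| - 1)%N *: << gdel G E' >>.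

End Digraphs.

(* Main.v *)
Require Import Defs.
From HB Require Import structures.
From mathcomp Require Import all_boot all_algebra.
From mathcomp.multinomials Require Import freeg.

Import GRing.Theory.
Local Open Scope ring_scope.

(** Fix a total order [O] and let [B] be the set of edges of [G] that [O]
    reverses. Then [O] is a linear extension of [G \ E'] iff [B] is a subset of
    [E'], so the coefficient of [O] in the sum of [(-1)^|E'| phi (G \ E')] over
    all [E'] included in [HE(C)] is an alternating sum over an interval of the
    Boolean lattice; it vanishes unless [B = HE(C)]. That case is impossible:
    every step of [C] would be non-increasing for [O], hence constant since [C]
    is closed, whereas a constant step is a loop of [G] that [O] reverses. *)

(** If [A] is not included in [B], the sum is empty. Otherwise some [x] lies in [B] but not in [A],
    and toggling [x] pairs off the sets of the interval with opposite signs. *)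
Lemma sum_sign_interval (R : pzRingType) (T : finType) (A B : {set T}) :
  A != B ->
  \sum_(E : {set T} | (A \subset E) && (E \subset B)) (-1) ^+ #|E| = 0 :> R.
Proof.
move=> neqAB; case: (boolP (A \subset B)) => [sAB | nsAB]; last first.
  rewrite big1 // => E /andP[sAE sEB].
  by rewrite (subset_trans sAE sEB) in nsAB.
have /properP[_ [x Bx nAx]] : A \proper B by rewrite properEneq neqAB.
rewrite (bigID (fun E : {set T} => x \in E)) /=.
(* The sets containing [x] are indexed by those avoiding it, so that both halves run over the same
   family. *)
rewrite (reindex_onto (fun E => x |: E) (fun E => E :\ x)) /=; last first.
  by move=> E /andP[_ Ex]; rewrite setD1K.
rewrite (eq_bigl (fun E : {set T} =>
    (A \subset E) && (E \subset B) && (x \notin E))); last first.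
  move=> E; rewrite setU11 andbT subUset sub1set Bx /=.
  case: (boolP (x \in E)) => [Ex | nEx].
    rewrite andbF; apply/negP => /andP[_ /eqP eqE].
    by move: Ex; rewrite -eqE !inE eqxx.
  by rewrite setU1K // eqxx !andbT -subDset (setDidPl _) // disjoint_sym disjoints1.
rewrite -big_split big1 //= => E /andP[_ nEx].
by rewrite cardsU1 nEx exprS mulN1r addNr.
Qed.

Lemma scale_freegU (R : nzRingType) (K : choiceType) (c k : R) (x : K) :
  c *: << k *g x >> = << c * k *g x >>.
Proof. by apply/eqP/freeg_eqP => y; rewrite coeffZ !coeffU mulrA. Qed.

Section CycleRelation.
Variable V : finType.
Implicit Types (G E O : {set V * V}) (C : seq (V * V)).

Definition reversed G O : {set V * V} :=
  [set e in G | ~~ ord_le O (alpha e) (omega e)].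

Lemma linear_extensions_gdel G E O :
  (O \in linear_extensions (gdel G E)) = total_order O && (reversed G O \subset E).
Proof.
rewrite inE; congr (_ && _); apply/forall_inP/subsetP => [le_O e | sE e].
  rewrite inE => /andP[Ge]; apply: contraNT => nEe.
  by apply: le_O; rewrite inE nEe.
by rewrite inE => /andP[nEe Ge]; apply: contraNT nEe => gt_e; apply: sE; rewrite inE Ge.
Qed.

Lemma total_orderP O : total_order O ->
  [/\ reflexive (ord_le O), antisymmetric (ord_le O),
      transitive (ord_le O) & total (ord_le O)].
Proof.
case/and4P=> /forallP rfl /forallP asym /forallP trs /forallP tot; split=> //.
- by move=> x y; move/forallP/(_ y)/implyP: (asym x) => h /h /eqP.
- move=> y x z xy yz; move/forallP/(_ y)/forallP/(_ z)/implyP: (trs x); apply.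
  exact/andP.
- by move=> x y; move/forallP: (tot x).
Qed.

Lemma last_omega_le O e p :
    reflexive (ord_le O) -> transitive (ord_le O) ->
    path (fun e f => omega e == alpha f) e p ->
    {in p, forall f, ord_le O (omega f) (alpha f)} ->
  ord_le O (omega (last e p)) (omega e).
Proof.
move=> rfl trs; elim: p e => [|f p IHp] e //= /andP[/eqP ef fp] le_p.
apply: (trs (omega f)); last by rewrite ef le_p ?mem_head.
by apply: IHp => // g pg; rewrite le_p // inE pg orbT.
Qed.

Lemma reversed_neq_HE G C O :
  is_cycle G C -> total_order O -> reversed G O != HE G C.
Proof.
case/and5P=> nzC /allP GC cyC _ /andP[_ /allP backC].
case/total_orderP=> rfl asym trs tot; apply: contraNneq nzC => eqHE.
have revP f : f \in C -> f \in G -> ~~ ord_le O (alpha f) (omega f).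
  move=> Cf Gf; have : f \in reversed G O by rewrite eqHE inE Cf.
  by rewrite inE => /andP[].
have leC f : f \in C -> ord_le O (omega f) (alpha f).
  move=> Cf; case: (boolP (f \in G)) => [Gf | nGf].
    by move: (tot (alpha f) (omega f)); rewrite (negPf (revP f Cf Gf)).
  have Gbf : ebar f \in G by move: (GC f Cf); rewrite (negPf nGf).
  (* Were [ebar f] reversed, it would lie in [C], and the last clause of [is_cycle] would put [f] in
     [G]. *)
  have : ebar f \notin reversed G O.
    rewrite eqHE inE negb_and; apply/orP; left.
    by apply: contra nGf => Cbf; exact: (implyP (backC f Cf)).
  by rewrite inE Gbf negbK.
case: C cyC GC {backC eqHE} revP leC => //= e p.
rewrite rcons_path => /andP[ep /eqP last_e] GC revP leC.
have Ce : e \in e :: p := mem_head e p.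
have le_e : ord_le O (alpha e) (omega e).
  (* The steps after [e] lead from [omega e] back to [alpha e] without ever going up in [O]. *)
  rewrite -last_e last_omega_le // => f pf.
  by rewrite leC // inE pf orbT.
have eq_e : alpha e = omega e by apply: asym; rewrite le_e leC.
(* A loop is its own reverse, so [e] is in [G] whichever way [C] traverses it. *)
have ebar_e : ebar e = e by case: (e) eq_e => a b; rewrite /ebar /alpha /omega /= => ->.
have Ge : e \in G by move: (GC e Ce); rewrite ebar_e orbb.
by move: (revP e Ce Ge); rewrite le_e.
Qed.

Lemma alternating_sum_phi G C : is_cycle G C ->
  \sum_(E : {set V * V} | E \subset HE G C)
     (-1 : int) ^+ #|E| *: phi (gdel G E) = 0.
Proof.
move=> hC; under eq_bigr do rewrite /phi scaler_sumr.
(* With the order [O] outermost, the inner sum of signs runs over the interval from [reversed G O]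
   to [HE G C]. *)
rewrite (exchange_big_dep (@total_order V)) /=; last first.
  by move=> E O _; rewrite linear_extensions_gdel => /andP[].
rewrite big1 // => O totO; rewrite -scaler_suml.
under eq_bigl do rewrite linear_extensions_gdel totO andbC.
by rewrite sum_sign_interval ?scale0r // reversed_neq_HE.
Qed.

Lemma phi_eq_alternating_sum G C : is_cycle G C ->
  phi G = \sum_(E : {set V * V} | (E \subset HE G C) && (E != set0))
            (-1 : int) ^+ (#|E| - 1)%N *: phi (gdel G E).
Proof.
move=> /alternating_sum_phi; rewrite (bigD1 set0) ?sub0set //=.
rewrite cards0 expr0 scale1r {1}/gdel setD0 => /eqP; rewrite addr_eq0 => /eqP->.
rewrite -sumrN; apply: eq_bigr => E /andP[_ nE0].
(* As [E] is nonempty, the truncated [#|E| - 1] is a true predecessor. *)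
by rewrite -{1}(subnK (n := #|E|) (m := 1)) ?card_gt0 // addn1 exprS mulN1r scaleNr opprK.
Qed.

(** This lets [raddf_sum] carry [phi_lin] through the sum [T_op]. *)
HB.instance Definition _ :=
  GRing.isZmodMorphism.Build {freeg (digraph V) / int} {freeg (seq V) / int}
    (@phi_lin V) (lift_is_additive (@phi V)).

End CycleRelation.

Theorem mainTheorem1 (V : finType) (G : digraph V) (C : seq (V * V))
    (hC : is_cycle G C) :
  phi G = phi_lin (T_op G C) /\
  phi G = \sum_(E' : {set V * V} | (E' \subset HE G C) && (E' != set0))
            (-1 : int) ^+ (#|E'| - 1)%N *: phi (gdel G E').
Proof.
split; last exact: phi_eq_alternating_sum.
rewrite (phi_eq_alternating_sum _ G C hC) /T_op raddf_sum /=.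
(* The sign moves inside the generator, the form on which [liftU] computes. *)
by apply: eq_bigr => E _; rewrite scale_freegU mulr1 /phi_lin liftU.
Qed.
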